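(* For every integer $n\geq 8$, $\sigma^{-}(C_n^{3})=12$.
   Context: $C_n$ denotes the cycle on $n$ vertices $u_0,\dots,u_{n-1}$, and $C_n^3$ is its cube: the graph on the same vertices in which $u_i$ is adjacent to $u_{i\pm1}$, $u_{i\pm2}$ and $u_{i\pm3}$ (indices mod $n$). For a graph $G$ on $n$ vertices, the rna number $\sigma^{-}(G)$ is the minimum, over all partitions $V(G)=A\cup B$ with $A\cap B=\emptyset$ and $||A|-|B||\leq 1$, of the number of edges of $G$ with one endpoint in $A$ and the other in $B$ (equivalently, the least number of negative edges among all parity signed graphs over $G$). *)

(* Defs.v *)
From HB Require Import structures.
From mathcomp Require Import all_boot.

Set Implicit Arguments.
Unset Strict Implicit.
Unset Printing Implicit Defensive.

Record sgraph := SGraph {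
  vertex :> finType;
  adj : rel vertex;
  adj_sym : symmetric adj;
  adj_irrefl : irreflexive adj
}.

Definition edges (G : sgraph) : {set {set G}} :=
  [set [set p.1; p.2] | p : G * G & adj p.1 p.2].

Definition cut_edges (G : sgraph) (A B : {set G}) : {set {set G}} :=
  [set E in edges G | [exists x in A, exists y in B, E == [set x; y]]].

Definition balanced_bipartition (T : finType) (A B : {set T}) : bool :=
  [&& A :|: B == [set: T], A :&: B == set0,
      #|A| <= #|B| + 1 & #|B| <= #|A| + 1].

Definition balanced_cut_size (G : sgraph) (k : nat) : bool :=
  [exists A : {set G}, exists B : {set G},
     balanced_bipartition A B && (#|cut_edges A B| == k)].

Lemma balanced_cut_size_ex (G : sgraph) : exists k, balanced_cut_size G k.
Proof.
pose A : {set G} := [set x in take #|G|./2 (enum G)].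
exists #|cut_edges A (~: A)|.
apply/existsP; exists A; apply/existsP; exists (~: A).
rewrite eqxx andbT /balanced_bipartition setUCr setICr !eqxx /=.
have le_half : #|G|./2 <= #|G|.
  by rewrite -{2}(odd_double_half #|G|) -addnn addnA leq_addl.
have cA : #|A| = #|G|./2.
  rewrite cardsE (card_uniqP _) ?take_uniq ?enum_uniq //.
  by rewrite size_takel // -cardE.
have cC : #|~: A| = odd #|G| + #|G|./2.
  apply/eqP; rewrite -(eqn_add2l #|A|) cardsC cA addnCA addnn.
  by rewrite odd_double_half.
by rewrite cA cC [odd _ + _]addnC -addnA leq_addr leq_add2l leq_b1.
Qed.

Definition rna (G : sgraph) : nat := ex_minn (balanced_cut_size_ex G).

(* The conjunct [i != j] only matters for n <= 3, where i + d may be i mod n. *)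
Definition cycle_cube_adj (n : nat) : rel 'I_n := fun i j =>
  (i != j) &&
  has (fun d => (j == i + d %[mod n]) || (i == j + d %[mod n])) [:: 1; 2; 3].

Lemma cycle_cube_adj_sym n : symmetric (@cycle_cube_adj n).
Proof.
move=> i j; rewrite /cycle_cube_adj eq_sym; congr (_ && _).
by apply: eq_has => d; rewrite orbC.
Qed.

Lemma cycle_cube_adj_irrefl n : irreflexive (@cycle_cube_adj n).
Proof. by move=> i; rewrite /cycle_cube_adj eqxx. Qed.

Definition cycle_cube (n : nat) : sgraph :=
  SGraph (@cycle_cube_adj_sym n) (@cycle_cube_adj_irrefl n).

(* Main.v *)
Require Import Defs.
From mathcomp Require Import all_boot.
From mathcomp Require Import zify.

(** Encode a vertex set by an [n]-periodic word [x : nat -> bool]; for [7 <= n]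
    the cut has size [\sum_(i < n) ahead x i], where [ahead x i] counts the
    letters among the next three that differ from [x i].
    If some three consecutive letters agree, cut the cycle open there and call
    the other letter a one: in linear order the first, second and third one see
    at most 0, 1 and 2 ones among their three left neighbours, so the [k] ones
    span at most [3k - 6] edges and the cut has size at least
    [6k - 2(3k - 6) = 12].
    Otherwise any three consecutive values of [ahead x] sum to at least 4, so
    three times the cut is at least [4n >= 32]; as the cut size is even, it is
    at least 12.  Two complementary arcs attain 12. *)

Set Implicit Arguments.
Unset Strict Implicit.
Unset Printing Implicit Defensive.

Definition ahead (x : nat -> bool) (i : nat) : nat :=
  (x i != x i.+1) + (x i != x i.+2) + (x i != x i.+3).

Lemma sum_periodic_shift (n : nat) (f : nat -> nat) (s : nat) :
  (forall i, f (i + n) = f i) -> \sum_(i < n) f (s + i) = \sum_(i < n) f i.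
Proof.
move=> fP; elim: s => [|s IHs]; first by [].
rewrite -IHs; case: n fP {IHs} => [|n] fP; first by rewrite !big_ord0.
rewrite big_ord_recr [RHS]big_ord_recl /= addn0 addSnnS fP addnC.
by congr (_ + _); apply: eq_bigr => i _; rewrite /bump addSnnS.
Qed.

Lemma ahead_periodic (n : nat) (x : nat -> bool) :
  (forall i, x (i + n) = x i) -> forall i, ahead x (i + n) = ahead x i.
Proof. by move=> xP i; rewrite /ahead -!addSn !xP. Qed.

Definition boundary_bound (k : nat) : nat :=
  match k with 0 => 0 | 1 => 6 | 2 => 10 | _ => 12 end.

(* The left-hand side is the cut size obtained if the prefix of length [m + 3]
   is completed by zeros only. *)
Lemma prefix_boundary (x : nat -> bool) (m : nat) :
  x 0 = false -> x 1 = false -> x 2 = false ->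
  let k := \sum_(i < m) x (i + 3) in
  x m + x m.+1 + x m.+2 <= k /\
  boundary_bound k <= \sum_(i < m) ahead x i
    + ((x m != x m.+1) + (x m != x m.+2) + (x m.+1 != x m.+2))
    + (x m + 2 * x m.+1 + 3 * x m.+2).
Proof.
move=> x0 x1 x2 /=; elim: m => [|m [IHk IHb]].
  by rewrite !big_ord0 x0 x1 x2.
rewrite !big_ord_recr /= addn3 /ahead.
move: IHk IHb; move: (\sum_(i < m) _) => k; move: (\sum_(i < m) _) => c.
case: (x m) (x m.+1) (x m.+2) (x m.+3) => [] [] [] [];
  by case: k => [|[|[|k]]]; rewrite ?addn0 ?addn1 /=; lia.
Qed.

Lemma cyclic_boundary_gap0 (n : nat) (x : nat -> bool) :
  (forall i, x (i + n) = x i) ->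
  x 0 = false -> x 1 = false -> x 2 = false ->
  3 <= \sum_(i < n) x i -> 12 <= \sum_(i < n) ahead x i.
Proof.
move=> xP x0 x1 x2 k3; have [_] := prefix_boundary n x0 x1 x2.
have -> : \sum_(i < n) x (i + 3) = \sum_(i < n) x i.
  rewrite -[RHS](@sum_periodic_shift n x 3) => [|i]; last by rewrite xP.
  by apply: eq_bigr => i _; rewrite addnC.
rewrite -[n in x n]add0n -[n in x n.+1]add0n -[n in x n.+2]add0n -!addSn !xP.
rewrite x0 x1 x2 /= !addn0.
by move: k3; case: (\sum_(i < n) x i) => [|[|[|k]]].
Qed.

Lemma cyclic_boundary_gap (n : nat) (x : nat -> bool) (s : nat) :
  (forall i, x (i + n) = x i) -> x s = x s.+1 -> x s = x s.+2 ->
  3 <= \sum_(i < n) x i -> 3 <= \sum_(i < n) ~~ x i ->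
  12 <= \sum_(i < n) ahead x i.
Proof.
move=> xP e1 e2 k3 k3'; pose y i := x s (+) x (s + i).
have yP i : y (i + n) = y i by rewrite /y addnA xP.
have yx : \sum_(i < n) ahead y i = \sum_(i < n) ahead x i.
  rewrite -(sum_periodic_shift s (ahead_periodic xP)); apply: eq_bigr => i _.
  rewrite /ahead /y !addnS.
  by case: (x s) (x (s + i)) (x _.+1) (x _.+2) (x _.+3) => [] [] [] [] [].
rewrite -yx; apply: cyclic_boundary_gap0 => //.
- by rewrite /y addn0 addbb.
- by rewrite /y addn1 -e1 addbb.
- by rewrite /y addn2 -e2 addbb.
rewrite /y; case: (x s).
  by rewrite (@sum_periodic_shift n (fun i => ~~ x i)) // => i; rewrite xP.
by rewrite (@sum_periodic_shift n x) // => i; rewrite xP.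
Qed.

Lemma cyclic_boundary_even (n : nat) (x : nat -> bool) :
  (forall i, x (i + n) = x i) -> ~~ odd (\sum_(i < n) ahead x i).
Proof.
move=> xP; have xPn i : (x (i + n) : nat) = x i by rewrite xP.
have -> : odd (\sum_(i < n) ahead x i) =
  odd (\sum_(i < n) (x (0 + i) + x (0 + i) + x (0 + i)
                        + x (1 + i) + x (2 + i) + x (3 + i))).
  elim: (n : nat) => [|m IHm]; first by rewrite !big_ord0.
  rewrite !big_ord_recr /= !oddD -IHm /ahead !addSn !add0n; congr (_ (+) _).
  by case: (x m) (x m.+1) (x m.+2) (x m.+3) => [] [] [] [].
rewrite !big_split /= !(sum_periodic_shift _ xPn).
by rewrite !oddD; case: odd.
Qed.

Lemma cyclic_boundary_no_gap (n : nat) (x : nat -> bool) :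
  8 <= n -> (forall i, x (i + n) = x i) ->
  (forall i, ~~ ((x i == x i.+1) && (x i == x i.+2))) ->
  12 <= \sum_(i < n) ahead x i.
Proof.
move=> n8 xP ngap; have aP := ahead_periodic xP.
have : \sum_(i < n) 4 <= \sum_(i < n) (ahead x i + ahead x (1 + i) + ahead x (2 + i)).
  apply: leq_sum => i _; move: (ngap i) (ngap i.+1) (ngap i.+2) (ngap i.+3).
  rewrite /ahead !addSn !add0n.
  by case: (x i) (x i.+1) (x i.+2) (x i.+3) (x i.+4) (x i.+4.+1)
    => [] [] [] [] [] [].
rewrite 2!big_split /= !(sum_periodic_shift _ aP) sum_nat_const card_ord.
have := cyclic_boundary_even xP; move: (\sum_(i < n) ahead x i) => c.
by move=> ev; have -> : c = c./2.*2 by [rewrite even_halfK]; lia.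
Qed.

Lemma cyclic_boundary (n : nat) (x : nat -> bool) :
  8 <= n -> (forall i, x (i + n) = x i) ->
  3 <= \sum_(i < n) x i -> 3 <= \sum_(i < n) ~~ x i ->
  12 <= \sum_(i < n) ahead x i.
Proof.
move=> n8 xP k3 k3'.
pose gap (i : 'I_n) := (x i == x i.+1) && (x i == x i.+2).
have [/existsP[i /andP[/eqP e1 /eqP e2]]|/existsPn ngap] := boolP [exists i, gap i].
  exact: (@cyclic_boundary_gap n x i).
apply: cyclic_boundary_no_gap => // i.
have n0 : 0 < n by apply: leq_trans n8.
have xm j : x (i %% n + j) = x (i + j).
  rewrite [in RHS](divn_eq i n); elim: (i %/ n) => [|q IHq]; first by [].
  by rewrite IHq -xP; congr x; rewrite mulSn; lia.
have := ngap (Ordinal (ltn_pmod i n0)); rewrite /gap /=.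
by have := (xm 0, xm 1, xm 2); rewrite !addn0 !addn1 !addn2 => -[[-> ->] ->].
Qed.

Lemma sum_interval (n a d : nat) : \sum_(i < n) (a <= i < a + d) <= d.
Proof.
suff: \sum_(i < n) (a <= i < a + d) = minn n (a + d) - minn n a by lia.
elim: n => [|n IHn]; first by rewrite big_ord0; lia.
by rewrite big_ord_recr /= IHn; case: leqP => ?; case: ltnP => ? /=; lia.
Qed.

Lemma arc_boundary (n h : nat) :
  3 <= h -> h + 3 <= n ->
  \sum_(i < n) ahead (fun i => i %% n < h) i <= 12.
Proof.
move=> h3 hn.
have jump d : 0 < d -> d <= 3 ->
    \sum_(i < n) ((i %% n < h) != ((i + d) %% n < h)) <= d + d.
  move=> d0 d3.
  apply: leq_trans (leq_add (sum_interval n (h - d) d) (sum_interval n (n - d) d)).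
  rewrite -big_split /=; apply: leq_sum => -[i /= lti] _; rewrite modn_small //.
  rewrite !subnK; [|lia|lia]; rewrite lti andbT.
  have [idn|nid] := ltnP (i + d) n.
    rewrite modn_small //.
    by case: (ltnP i h) => ?; case: (ltnP (i + d) h) => ?; case: leqP => ? //=; lia.
  rewrite -[X in X %% n](subnK nid) modnDr modn_small; last lia.
  by case: (leqP (n - d) i) => ?; [case: (_ != _); lia|lia].
rewrite /ahead !big_split /=.
apply: (@leq_trans ((1 + 1) + (2 + 2) + (3 + 3))) => //.
have J d := jump d.+1 isT.
apply: leq_add; first apply: leq_add.
- by apply: leq_trans (J 0 isT); apply: leq_sum => i _; rewrite addn1.
- by apply: leq_trans (J 1 isT); apply: leq_sum => i _; rewrite addn2.
- by apply: leq_trans (J 2 isT); apply: leq_sum => i _; rewrite addn3.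
Qed.

Section CutSize.

Variables (n : nat) (n7 : 7 <= n).

Let n0 : 0 < n. Proof. exact: leq_trans n7. Qed.

Let vert (i : nat) : 'I_n := Ordinal (ltn_pmod i n0).

Definition word (A : {set cycle_cube n}) (i : nat) : bool := vert i \in A.

Lemma word_ord (A : {set cycle_cube n}) (i : 'I_n) : word A i = (i \in A).
Proof. by rewrite /word; congr (_ \in A); apply: val_inj; rewrite /= modn_small. Qed.

Lemma word_periodic (A : {set cycle_cube n}) (i : nat) : word A (i + n) = word A i.
Proof. by rewrite /word; congr (_ \in A); apply: val_inj; rewrite /= modnDr. Qed.

Lemma sum_word (A : {set cycle_cube n}) : \sum_(i < n) word A i = #|A|.
Proof.
rewrite -sum1_card [RHS]big_mkcond /=; apply: eq_bigr => i _.
by rewrite word_ord; case: (i \in A).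
Qed.

Let shift (p : 'I_n * 'I_3) : 'I_n := vert (p.1 + p.2.+1).

Let edge (p : 'I_n * 'I_3) : {set cycle_cube n} := [set p.1; shift p].

Let add_modn_neq (i : 'I_n) (d : nat) : 0 < d -> d < n -> (i + d) %% n != i.
Proof.
move=> d0 dn; rewrite -[X in _ != X](modn_small (ltn_ord i)).
by rewrite -[X in _ != X %% n]addn0 eqn_modDl mod0n modn_small // -lt0n.
Qed.

Let shift_neq (p : 'I_n * 'I_3) : shift p != p.1.
Proof. by apply: add_modn_neq => //; have := ltn_ord p.2; lia. Qed.

Let edge_inj : injective edge.
Proof.
move=> [i d] [j e] E.
have : i \in edge (j, e) by rewrite -E !inE eqxx.
have : shift (i, d) \in edge (j, e) by rewrite -E !inE eqxx orbT.
have := ltn_ord d; have := ltn_ord e => lte ltd.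
rewrite !inE /= => /orP[]/eqP Ed /orP[]/eqP Ei.
- by have := shift_neq (i, d); rewrite Ed Ei eqxx.
- have := @add_modn_neq j (e.+1 + d.+1) isT.
  move: Ed; rewrite Ei => /(congr1 val) /=; rewrite modnDml addnA => ->.
  by move=> /(_ ltac:(lia)); rewrite eqxx.
- move: Ed; rewrite Ei => /(congr1 val) /= /eqP; rewrite eqn_modDl.
  rewrite !modn_small; [|lia|lia] => /eqP[de].
  by congr (_, _); apply: val_inj.
- by have := shift_neq (i, d); rewrite Ed {1}Ei eqxx.
Qed.

Let adj_shift (i j : 'I_n) :
  cycle_cube_adj i j = [exists d, (j == shift (i, d)) || (i == shift (j, d))].
Proof.
rewrite /cycle_cube_adj; apply/andP/existsP => [[_ /hasP[d d13 Hd]]|[d Hd]].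
  have ltd : d.-1 < 3 by move: d13; rewrite !inE => /or3P[]/eqP->.
  have dE : d.-1.+1 = d by move: d13; rewrite !inE => /or3P[]/eqP->.
  exists (Ordinal ltd); rewrite -!val_eqE /= dE.
  by move: Hd; rewrite (modn_small (ltn_ord i)) (modn_small (ltn_ord j)).
split.
  by case/orP: Hd => /eqP->; rewrite ?[_ == shift _]eq_sym ?shift_neq //;
    rewrite shift_neq.
apply/hasP; exists d.+1; first by case: d {Hd} => [[|[|[|d]]]].
by rewrite (modn_small (ltn_ord i)) (modn_small (ltn_ord j)).
Qed.

Lemma card_cut_edges (A : {set cycle_cube n}) :
  #|cut_edges A (~: A)| = \sum_(i < n) ahead (word A) i.
Proof.
pose P := [set p : 'I_n * 'I_3 | (p.1 \in A) != (shift p \in A)].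
have -> : cut_edges A (~: A) = edge @: P.
  apply/setP => E; apply/idP/imsetP => [|[p]].
    rewrite inE => /andP[/imsetP[[i j]]]; rewrite inE /= => ij -> .
    case/existsP=> x /andP[xA /existsP[y /andP[yA /eqP Eij]]].
    have ijA : (i \in A) != (j \in A).
      move: yA; rewrite inE => yA.
      have : x \in [set i; j] by rewrite Eij !inE eqxx.
      have : y \in [set i; j] by rewrite Eij !inE eqxx orbT.
      rewrite !inE => /orP[]/eqP Ey /orP[]/eqP Ex; move: xA yA;
        by rewrite Ex Ey; do 2!case: (_ \in A).
    move: ij; rewrite adj_shift => /existsP[d /orP[]/eqP Ed].
      by exists (i, d); rewrite ?inE /edge /= -Ed.
    by exists (j, d); rewrite ?inE /edge /= -Ed 1?eq_sym // setUC.
  rewrite inE => pA ->; rewrite inE; apply/andP; split.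
    apply/imsetP; exists (p.1, shift p) => //; rewrite inE.
    by rewrite /= adj_shift; apply/existsP; exists p.2; case: p {pA} => ? ?; rewrite eqxx.
  have [p1|p1] := boolP (p.1 \in A).
    apply/existsP; exists p.1; rewrite p1; apply/existsP; exists (shift p).
    by move: pA; rewrite p1 inE eqxx; case: (_ \in A).
  apply/existsP; exists (shift p); move: pA; rewrite (negPf p1).
  case: (shift p \in A) => //= _; apply/existsP; exists p.1.
  by rewrite inE p1 /edge setUC eqxx.
rewrite card_imset // -sum1_card big_mkcond /=.
rewrite (eq_bigr (fun p => ((p.1 \in A) != (shift p \in A) : nat))); last first.
  by move=> p _; rewrite inE; case: (_ != _).
rewrite -(pair_bigA _ (fun i d => ((i \in A) != (shift (i, d) \in A) : nat))) /=.
apply: eq_bigr => i _; rewrite !big_ord_recl big_ord0 /ahead /=.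
by rewrite word_ord /word /shift /= addn1 addn2 addn3 addn0 addnA.
Qed.

End CutSize.

Lemma balanced_bipartition_card (T : finType) (A B : {set T}) :
  balanced_bipartition A B ->
  [/\ B = ~: A, #|T|./2 <= #|A| & #|T|./2 <= #|~: A|].
Proof.
case/and4P=> /eqP AUB /eqP AIB leAB leBA.
have BE : B = ~: A.
  apply/setP => x; rewrite inE; have := in_setT x; have := in_set0 x.
  by rewrite -AUB -AIB !inE; do 2!case: (_ \in _).
rewrite BE in leAB leBA; have := cardsC A; split=> //; lia.
Qed.

Lemma card_ord_lt (n h : nat) : h <= n -> #|[set i : 'I_n | i < h]| = h.
Proof.
move=> hn; rewrite -sum1_card big_mkcond /= -[RHS]card_ord -sum1_card.
rewrite (big_ord_widen n (fun=> 1)) // [RHS]big_mkcond /=.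
by apply: eq_bigr => i _; rewrite inE.
Qed.

Theorem theorem3p4 (n : nat) (hn : 8 <= n) : rna (cycle_cube n) = 12.
Proof.
have n7 : 7 <= n by apply: ltnW.
have lower k : balanced_cut_size (cycle_cube n) k -> 12 <= k.
  case/existsP=> A /existsP[B /andP[/balanced_bipartition_card[-> hA hC] /eqP<-]].
  rewrite (card_cut_edges n7); move: hA hC; rewrite card_ord => hA hC.
  apply: cyclic_boundary => //; first exact: word_periodic.
    by rewrite sum_word; lia.
  have -> : \sum_(i < n) ~~ word n7 A i = #|~: A|.
    rewrite -(sum_word n7); apply: eq_bigr => i _.
    by rewrite !word_ord in_setC.
  lia.
rewrite /rna; case: ex_minnP => k /lower k12 kmin.
apply/eqP; rewrite eqn_leq k12 andbT.
pose A : {set cycle_cube n} := [set i : 'I_n | i < n./2].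
have cA : #|A| = n./2 by apply: card_ord_lt; lia.
have cC : #|~: A| = n - n./2 by have := cardsC A; rewrite card_ord; lia.
apply: leq_trans (kmin #|cut_edges A (~: A)| _) _.
  apply/existsP; exists A; apply/existsP; exists (~: A).
  by rewrite eqxx andbT /balanced_bipartition setUCr setICr !eqxx cA cC /=; lia.
rewrite (card_cut_edges n7); apply: leq_trans (@arc_boundary n n./2 _ _); try lia.
by apply: leq_sum => i _; rewrite /ahead /word !inE.
Qed.
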